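(* Let $m\ge 2$, $n\ge 1$, let $\mathcal{A}=(a_{i_1\cdots i_m})\in T_{m,n}$ be strictly semi-positive, let $q\in\mathbb{R}^n$, and let $x$ be a solution of TCP$(\mathcal{A},q)$. Then $$\frac{\|(-q)_+\|_\infty}{n^{\frac{m-2}{2}}\max\limits_{i\in I_n}\left(\sum\limits_{i_2,\dots,i_m=1}^{n}|a_{ii_2\cdots i_m}|\right)}\le\|x\|_\infty^{m-1}\le\frac{\|(-q)_+\|_\infty}{\beta(\mathcal{A})}.$$
   Context: $T_{m,n}$ is the set of real tensors $\mathcal{A}=(a_{i_1\cdots i_m})$ of order $m$ and dimension $n$, with indices in $I_n=\{1,\dots,n\}$ and no symmetry assumed. For $x\in\mathbb{R}^n$, $\mathcal{A}x^{m-1}\in\mathbb{R}^n$ has components $(\mathcal{A}x^{m-1})_i=\sum_{i_2,\dots,i_m=1}^n a_{ii_2\cdots i_m}x_{i_2}\cdots x_{i_m}$. Inequalities between vectors are componentwise. $\mathcal{A}$ is strictly semi-positive if for each $x\ge 0$, $x\ne 0$, there is $k\in I_n$ with $x_k>0$ and $(\mathcal{A}x^{m-1})_k>0$. A solution of the tensor complementarity problem TCP$(\mathcal{A},q)$ is a vector $x\in\mathbb{R}^n$ with $x\ge 0$, $q+\mathcal{A}x^{m-1}\ge 0$ and $x^\top(q+\mathcal{A}x^{m-1})=0$. $x_+=(\max\{x_1,0\},\dots,\max\{x_n,0\})^\top$ and $\|x\|_\infty=\max_i|x_i|$. $\beta(\mathcal{A}):=\min_{x\ge 0,\ \|x\|_\infty=1}\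 \max_{i\in I_n}x_i(\mathcal{A}x^{m-1})_i$. *)

(* Defs.v *)
From HB Require Import structures.
From mathcomp Require Import all_boot all_order all_algebra.
From mathcomp Require Import all_classical all_reals all_analysis.

Set Implicit Arguments.
Unset Strict Implicit.
Unset Printing Implicit Defensive.

Import Order.TTheory GRing.Theory Num.Theory.
Import numFieldNormedType.Exports.

Local Open Scope classical_set_scope.
Local Open Scope ring_scope.

Definition tensor (R : realType) (m n : nat) := {ffun m.-tuple 'I_n -> R}.

(* The condition ohead t == Some i fixes the first index of t to be i, so the
   sum ranges over the remaining indices, which form behead t. *)
Definition tapp (R : realType) (m n : nat) (A : tensor R m n) (x : 'rV[R]_n)
    : 'rV[R]_n :=
  \row_i \sum_(t : m.-tuple 'I_n | ohead t == Some i)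
            A t * \prod_(j <- behead t) x 0 j.

Definition abs_row_sum (R : realType) (m n : nat) (A : tensor R m n) (i : 'I_n)
    : R :=
  \sum_(t : m.-tuple 'I_n | ohead t == Some i) `|A t|.

(* A bigop would need a default value below all the F i, which R does not have;
   the supremum of the finite set of values is their maximum when n > 0 (see
   vmax_attained). *)
Definition vmax (R : realType) (n : nat) (F : 'I_n -> R) : R := sup (range F).

Definition vnonneg (R : realType) (n : nat) (x : 'rV[R]_n) : Prop :=
  forall i, 0 <= x 0 i.

Definition vpos_part (R : realType) (n : nat) (x : 'rV[R]_n) : 'rV[R]_n :=
  \row_i Num.max (x 0 i) 0.

Definition strictly_semi_positive (R : realType) (m n : nat)
    (A : tensor R m n) : Prop :=
  forall x : 'rV[R]_n, vnonneg x -> x != 0 ->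
    exists k : 'I_n, 0 < x 0 k /\ 0 < tapp A x 0 k.

Definition TCP_solution (R : realType) (m n : nat) (A : tensor R m n)
    (q x : 'rV[R]_n) : Prop :=
  [/\ vnonneg x, vnonneg (q + tapp A x) & x *m (q + tapp A x)^T = 0].

(* The norm of the library on matrices is the sup norm. *)
Definition unit_nonneg (R : realType) (n : nat) : set 'rV[R]_n :=
  [set x | vnonneg x /\ `|x| = 1].
Arguments unit_nonneg : clear implicits.

(* The infimum is attained when n > 0 (see tbeta_attained). *)
Definition tbeta (R : realType) (m n : nat) (A : tensor R m n) : R :=
  inf [set vmax (fun i => x 0 i * tapp A x 0 i) | x in unit_nonneg R n].

Lemma vmax_bigmax (R : realType) (n : nat) (F : 'I_n.+1 -> R) :
  vmax F = \big[Num.max/F ord0]_i F i.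
Proof.
have ub : ubound (range F) (\big[Num.max/F ord0]_i F i).
  by move=> _ [i _ <-]; exact: le_bigmax.
apply/eqP; rewrite eq_le; apply/andP; split.
  by apply: ge_sup => //; exists (F ord0), ord0.
have hs : has_ubound (range F) by eexists; exact: ub.
by apply/bigmax_leP; split=> [|i _]; apply: (ub_le_sup hs); eexists.
Qed.

Lemma vmax_attained (R : realType) (n : nat) (F : 'I_n -> R) : (0 < n)%N ->
  (exists i, vmax F = F i) /\ (forall i, F i <= vmax F).
Proof.
case: n F => // n F _; rewrite vmax_bigmax; split; last first.
  by move=> i; exact: le_bigmax.
apply: (big_ind (fun y => exists i, y = F i)) => [|x y [i ->] [j ->]|i _]; [by exists ord0| |by exists i].
by rewrite maxEle; case: ifP => _; [exists j|exists i].
Qed.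

Lemma tapp_continuous (R : realType) (m n : nat) (A : tensor R m n) (i : 'I_n) :
  continuous (fun x : 'rV[R]_n => tapp A x 0 i).
Proof.
have -> : (fun x : 'rV[R]_n => tapp A x 0 i) =
    (fun x => \sum_(t : m.-tuple 'I_n | ohead t == Some i)
                 A t * \prod_(j <- behead t) x 0 j).
  by apply/funext => x; rewrite mxE.
apply: continuous_big => [|t _]; first exact: add_continuous.
move=> x; apply: (@cvgM _ _ (nbhs x)); first exact: cvg_cst.
elim: (behead t) => [|j s IH].
  under eq_fun do rewrite big_nil.
  by rewrite big_nil; exact: cvg_cst.
under eq_fun do rewrite big_cons.
by rewrite big_cons; apply: (@cvgM _ _ (nbhs x)) => //; exact: coord_continuous.
Qed.

Lemma tbeta_attained (R : realType) (m n : nat) (A : tensor R m n) :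
  (0 < n)%N ->
  (exists2 x, unit_nonneg R n x &
     tbeta A = vmax (fun i => x 0 i * tapp A x 0 i)) /\
  (forall x, unit_nonneg R n x ->
     tbeta A <= vmax (fun i => x 0 i * tapp A x 0 i)).
Proof.
case: n A => // n A _.
pose f (x : 'rV[R]_n.+1) := vmax (fun i => x 0 i * tapp A x 0 i).
have cf : continuous f.
  have -> : f = fun x => \big[Num.max/x 0 ord0 * tapp A x 0 ord0]_i
                            (x 0 i * tapp A x 0 i).
    by apply/funext => x; exact: vmax_bigmax.
  pose g i (x : 'rV[R]_n.+1) := x 0 i * tapp A x 0 i.
  have cg i : continuous (g i).
    move=> x; apply: (@cvgM _ _ (nbhs x)); first exact: coord_continuous.
    exact: tapp_continuous.
  suff cb s : continuous (fun x => \big[Num.max/g ord0 x]_(i <- s) g i x).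
    exact: cb.
  elim: s => [|i s IH].
    by under eq_fun do rewrite big_nil; exact: cg.
  under eq_fun do rewrite big_cons.
  move=> x; exact: (continuous_max (cg i x) (IH x)).
have U0 : unit_nonneg R n.+1 !=set0.
  exists (const_mx 1); split; first by move=> i; rewrite mxE.
  rewrite [LHS]mx_normrE; apply/eqP; rewrite eq_le; apply/andP; split.
    by apply/bigmax_leP; split=> // ij _; rewrite mxE normr1.
  by apply: (le_trans _ (le_bigmax _ _ (ord0, ord0))); rewrite mxE normr1.
have cU : compact (unit_nonneg R n.+1).
  apply: bounded_closed_compact.
    by exists 1; split => // M M1 x [_ x1]; rewrite /= x1; exact: ltW.
  have -> : unit_nonneg R n.+1 =
      (\bigcap_i ((fun x : 'rV[R]_n.+1 => x 0 i) @^-1` [set y | 0 <= y])) `&`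
      ((fun x : 'rV[R]_n.+1 => `|x|) @^-1` [set 1]).
    apply/seteqP; split=> x [hx h1]; split => //; first by move=> i _; exact: hx.
    by move=> i; exact: hx.
  apply: closedI.
    apply: closed_bigI => i _; apply: preimage_closed; last exact: closed_ge.
    by move=> x _; exact: coord_continuous.
  apply: preimage_closed; last exact: closed_eq.
  by move=> x _; exact: norm_continuous.
have [c cU' hc] := EVT_min_rV U0 cU (continuous_subspaceT cf).
have lb : lbound [set f x | x in unit_nonneg R n.+1] (f c).
  by move=> _ [x xU <-]; apply: hc; rewrite inE.
have E : tbeta A = f c.
  apply/eqP; rewrite eq_le; apply/andP; split.
    apply: ge_inf; first by exists (f c).
    by exists c => //; rewrite -inE.
  by apply: lb_le_inf => //; exists (f c), c => //; rewrite -inE.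
split; first by exists c => //; rewrite -inE.
by move=> x xU; rewrite E; apply: hc; rewrite inE.
Qed.

(* Main.v *)
Require Import Defs.
From mathcomp Require Import all_boot all_order all_algebra.
From mathcomp Require Import all_classical all_reals all_analysis.

Import Order.TTheory GRing.Theory Num.Theory.
Import numFieldNormedType.Exports.

Local Open Scope ring_scope.

(** Both bounds compare coordinates. Below, [- q <= A x^(m-1)] and each
    coordinate of [A x^(m-1)] is at most a row sum times [`|x| ^ (m-1)]. Above,
    [beta(A) > 0] bounds [max_i x_i (A x^(m-1))_i] from below by
    [beta(A) `|x| ^ m], by homogeneity, and complementarity replaces
    [x_i (A x^(m-1))_i] by [x_i (- q_i)], which is at most
    [`|x| `|(-q)_+|]. *)

Lemma coord_le_norm (R : realType) (n : nat) (x : 'rV[R]_n) (i : 'I_n) :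
  `|x 0 i| <= `|x|.
Proof.
by rewrite [leRHS]mx_normrE; apply: (le_trans _ (le_bigmax _ _ (0, i))).
Qed.

Lemma norm_le_coord (R : realType) (n : nat) (x : 'rV[R]_n) (c : R) :
  0 <= c -> (forall i, `|x 0 i| <= c) -> `|x| <= c.
Proof.
move=> c0 xc; rewrite [leLHS]mx_normrE; apply/bigmax_leP; split=> // -[i j] _.
by rewrite ord1; exact: xc.
Qed.

Lemma coord_le_norm_pos_part (R : realType) (n : nat) (x : 'rV[R]_n)
    (i : 'I_n) : x 0 i <= `|vpos_part x|.
Proof.
apply: le_trans (coord_le_norm _ _ (vpos_part x) i).
by apply: le_trans (ler_norm _); rewrite mxE le_max lexx.
Qed.

Lemma tappZ (R : realType) (m n : nat) (A : tensor R m n) (c : R)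
    (x : 'rV[R]_n) : tapp A (c *: x) = c ^+ (m - 1) *: tapp A x.
Proof.
apply/rowP => i; rewrite !mxE mulr_sumr; apply: eq_bigr => t _.
under eq_bigr do rewrite mxE.
rewrite big_split /= big_const_seq count_predT iter_mulr_1 size_behead.
by rewrite size_tuple -subn1 mulrCA.
Qed.

Lemma abs_tapp_le (R : realType) (m n : nat) (A : tensor R m n)
    (x : 'rV[R]_n) (i : 'I_n) :
  `|tapp A x 0 i| <= abs_row_sum A i * `|x| ^+ (m - 1).
Proof.
rewrite mxE mulr_suml; apply: (le_trans (ler_norm_sum _ _ _)).
apply: ler_sum => t _; rewrite normrM ler_wpM2l // normr_prod.
have -> : (m - 1)%N = size (behead t) by rewrite size_behead size_tuple subn1.
rewrite -iter_mulr_1 -[in leRHS]count_predT -big_const_seq.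
by apply: ler_prod => j _; rewrite normr_ge0 coord_le_norm.
Qed.

(** The minimum is attained at a nonzero [x], where strict semi-positivity makes one of the terms
    under the maximum positive. *)
Lemma tbeta_gt0 (R : realType) (m n : nat) (A : tensor R m n) :
  (0 < n)%N -> strictly_semi_positive A -> 0 < tbeta A.
Proof.
move=> n0 hA; have [[x [x0 x1] ->] _] := tbeta_attained A n0.
have xN0 : x != 0 by rewrite -normr_gt0 x1.
have [k [xk Axk]] := hA x x0 xN0.
by apply: lt_le_trans (mulr_gt0 xk Axk) _; exact: (vmax_attained _ n0).2.
Qed.

Lemma tbeta_homogeneous_le (R : realType) (m n : nat) (A : tensor R m n)
    (x : 'rV[R]_n) : (0 < n)%N -> vnonneg x -> x != 0 ->
  exists i, tbeta A * (`|x| * `|x| ^+ (m - 1)) <= x 0 i * tapp A x 0 i.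
Proof.
move=> n0 x0 xN0; have nx : 0 < `|x| by rewrite normr_gt0.
have yU : unit_nonneg R n (`|x|^-1 *: x).
  split=> [i|]; first by rewrite mxE mulr_ge0 ?invr_ge0.
  by rewrite normrZ gtr0_norm ?invr_gt0 // mulVf // gt_eqF.
have := (tbeta_attained A n0).2 _ yU.
set F := fun i : 'I_n => _; have [[i ->] _] := vmax_attained F n0.
rewrite /F tappZ [X in X * _]mxE [X in _ * X]mxE exprVn mulrACA -invfM mulrC => h; exists i.
by rewrite -ler_pdivlMr // mulr_gt0 // exprn_gt0.
Qed.

Lemma TCP_complementarity (R : realType) (m n : nat) (A : tensor R m n)
    (q x : 'rV[R]_n) (i : 'I_n) :
  TCP_solution A q x -> x 0 i * tapp A x 0 i = x 0 i * (- q) 0 i.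
Proof.
case=> x0 y0 /matrixP/(_ 0 0); rewrite !mxE => /eqP.
(* A vanishing sum of nonnegative terms vanishes term by term. *)
rewrite psumr_eq0 => [/allP/(_ i (mem_index_enum i))|j _]; last first.
  by rewrite [_^T _ _]mxE mulr_ge0.
by rewrite /= !mxE mulrDr addrC addr_eq0 mulrN => /eqP.
Qed.

Theorem theorem3p12 (R : realType) (m n : nat) (hm : (2 <= m)%N)
    (hn : (1 <= n)%N) (A : tensor R m n) (hA : strictly_semi_positive A)
    (q x : 'rV[R]_n) (hx : TCP_solution A q x) :
  `|vpos_part (- q)| /
      (n%:R `^ ((m%:R - 2) / 2) * vmax (abs_row_sum A))
    <= `|x| ^+ (m - 1)
  /\
  `|x| ^+ (m - 1) <= `|vpos_part (- q)| / tbeta A.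
Proof.
have [x0 y0 _] := hx; split.
- have [[i0 vE] vub] := vmax_attained (abs_row_sum A) hn.
  have v0 : 0 <= vmax (abs_row_sum A) by rewrite vE sumr_ge0.
  set D := _ * vmax _.
  (* The factor [n^((m-2)/2)] is at least 1, so the bound with the largest row sum alone is
     stronger. *)
  have vD : vmax (abs_row_sum A) <= D.
    rewrite ler_peMl // -[leLHS](powRr0 n%:R) ler_powR ?ler1n //.
    by rewrite divr_ge0 // subr_ge0 ler_nat.
  have [D0|] := ltP 0 D; last first.
    (* Here the quotient is 0, by the convention that the inverse of 0 is 0. *)
    move=> D0; have -> : D = 0 by apply/le_anti; rewrite D0 (le_trans v0).
    by rewrite invr0 mulr0 exprn_ge0.
  rewrite ler_pdivrMr // mulrC.
  apply: norm_le_coord => [|i]; first by rewrite mulr_ge0 ?exprn_ge0 // ltW.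
  (* Both arguments of [max (- q_i) 0] are bounded; feasibility handles [- q_i]. *)
  rewrite mxE ger0_norm ?le_max ?lexx ?orbT // ge_max.
  rewrite [X in _ && X]mulr_ge0 ?exprn_ge0 ?(ltW D0) // andbT.
  have := y0 i; rewrite !mxE -lerBlDl sub0r => /le_trans; apply.
  have := abs_tapp_le _ _ _ A x i; rewrite mxE.
  move=> /(le_trans (ler_norm _)) /le_trans; apply.
  by rewrite ler_wpM2r ?exprn_ge0 // (le_trans (vub i)).
- have b0 := tbeta_gt0 _ _ _ A hn hA.
  have [->|xN0] := eqVneq x 0.
    (* The exponent [m - 1] is nonzero as [2 <= m], so the power is 0 and not [0 ^ 0 = 1]. *)
    by rewrite normr0 expr0n subn_eq0 leqNgt hm divr_ge0 // ltW.
  have [i] := tbeta_homogeneous_le _ _ _ A x hn x0 xN0.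
  rewrite (TCP_complementarity _ _ _ _ q) // mulrCA ler_pdivlMr // => h.
  have nx : 0 < `|x| by rewrite normr_gt0.
  rewrite mulrC -(ler_pM2l nx); apply: (le_trans h).
  apply: (le_trans (ler_wpM2l (x0 i) (coord_le_norm_pos_part _ _ (- q) i))).
  by rewrite ler_wpM2r // (le_trans (ler_norm _)) // coord_le_norm.
Qed.
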